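(* Let $N\in\mathbb{N}$. Then for $|q|<1$, \begin{align*} \frac{1}{(q)_N}\sum_{n = 1}^{N} \genfrac{[}{]}{0pt}{}{N}{n}\frac{(-1)^{n - 1}nq^{n(n + 1)/2}}{1 - q^n} & + \sum_{n = 1}^{N} \genfrac{[}{]}{0pt}{}{N}{n} \frac{q^{n^2}}{(q)_n} \sum_{k=1}^n \frac{q^k}{(1-q^k)^2 } = \frac{1}{(q)_N} \sum_{n=1}^{\infty} \frac{n q^n(1- q^{N n})}{1- q^n}. \end{align*}
   Context: Here $(A)_n=(A;q)_n=(1-A)(1-Aq)\cdots(1-Aq^{n-1})$ with $(A)_0=1$, and $\genfrac{[}{]}{0pt}{}{N}{n}=\frac{(q;q)_N}{(q;q)_n(q;q)_{N-n}}$ for $0\le n\le N$ is the $q$-binomial coefficient. *)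

(* Defs.v *)
From mathcomp Require Import all_boot all_order all_algebra complex.
From mathcomp Require Import boolp classical_sets reals topology normedtype.
From mathcomp Require Import sequences.

Set Implicit Arguments.
Unset Strict Implicit.
Unset Printing Implicit Defensive.

Import GRing.Theory.
Local Open Scope ring_scope.

Definition qpoch (F : fieldType) (A q : F) (n : nat) : F :=
  \prod_(0 <= i < n) (1 - A * q ^+ i).

(* Only meaningful for n <= N: the subtraction N - n is truncated. *)
Definition qbinom (F : fieldType) (q : F) (N n : nat) : F :=
  qpoch q q N / (qpoch q q n * qpoch q q (N - n)).

(* Main.v *)
Require Import Defs.
From mathcomp Require Import all_boot all_order all_algebra complex.
From mathcomp Require Import boolp classical_sets reals topology normedtype.
From mathcomp Require Import sequences ring zify.

Import Order.TTheory GRing.Theory Num.Theory.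
Import numFieldNormedType.Exports.

Local Open Scope classical_set_scope.
Local Open Scope ring_scope.

(* Write (q)_n for qpoch q q n, L_N = sum_(k <= N) q^k / (1 - q^k)^2, and
   T_(N,n) = [N n] q^(n^2) (q)_N / (q)_n.  Expanding (1 - q^(Nn)) / (1 - q^n) as
   a finite geometric sum and using sum_n n x^n = x / (1 - x)^2, the infinite
   series equals L_N, so the claim is A_N + sum_n T_(N,n) L_n = L_N, where A_N
   is the alternating sum.  Pascal's rule and the derivative at 1 of the
   q-binomial theorem give A_(N+1) - A_N = q^(N+1) (q)_N / (1 - q^(N+1)).  The
   weights satisfy
     T_(N+1,n+1) = (1 - q^(N+n+2)) T_(N,n+1) + q^(N+n+1) T_(N,n),
   so sum_n T_(N,n) f(n) changes with N only through the increments of f: f = 1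
   gives sum_n T_(N,n) = 1, and f = L then gives the complementary increment
   q^(N+1) / (1 - q^(N+1))^2 - q^(N+1) (q)_N / (1 - q^(N+1)). *)

(** * Gaussian binomials over a field in which [q] is not a root of unity *)

Section FiniteIdentity.
Variables (F : fieldType) (q : F).
Hypothesis q_nonres : forall k, 1 - q ^+ k.+1 != 0.

Local Notation poch := (qpoch q q).

Definition lambert2 n : F := \sum_(1 <= k < n.+1) q ^+ k / (1 - q ^+ k) ^+ 2.

Lemma lambert2_0 : lambert2 0 = 0.
Proof. by rewrite /lambert2 big_nil. Qed.

Lemma qpoch0 : poch 0 = 1.
Proof. by rewrite /qpoch big_nil. Qed.

Lemma qpochS n : poch n.+1 = poch n * (1 - q ^+ n.+1).
Proof. by rewrite /qpoch big_nat_recr //= -exprS. Qed.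

Lemma qpoch_neq0 n : poch n != 0.
Proof.
elim: n => [|n IHn]; first by rewrite qpoch0 oner_eq0.
by rewrite qpochS mulf_neq0.
Qed.

(** Extended by 0 above the diagonal, where [qbinom] has no meaning, so that Pascal's rule holds for
    all indices. *)
Definition gauss N n : F := if (n <= N)%N then qbinom q N n else 0.

Lemma gaussE N n : (n <= N)%N -> gauss N n = qbinom q N n.
Proof. by rewrite /gauss => ->. Qed.

Lemma gauss_small N n : (N < n)%N -> gauss N n = 0.
Proof. by rewrite ltnNge /gauss => /negbTE->. Qed.

Lemma gaussn0 N : gauss N 0 = 1.
Proof. by rewrite gaussE // /qbinom subn0 qpoch0 mul1r divff ?qpoch_neq0. Qed.

Lemma gaussnn N : gauss N N = 1.
Proof. by rewrite gaussE // /qbinom subnn qpoch0 mulr1 divff ?qpoch_neq0. Qed.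

(** Trades the denominator of a summand for one independent of [n], which can leave the sum. *)
Lemma gauss_absorb N n :
  gauss N n / (1 - q ^+ n.+1) = gauss N.+1 n.+1 / (1 - q ^+ N.+1).
Proof.
rewrite /gauss ltnS; case: leqP => _; last by rewrite !mul0r.
rewrite /qbinom subSS !qpochS; field.
by rewrite !qpoch_neq0 !q_nonres.
Qed.

Lemma gauss_pascal N n :
  gauss N.+1 n.+1 = gauss N n.+1 + q ^+ (N - n) * gauss N n.
Proof.
have [lt_nN|] := ltnP n N; last first.
  rewrite leq_eqVlt => /predU1P[<-|lt_Nn].
    by rewrite !gaussnn subnn mul1r gauss_small ?add0r.
  by rewrite !gauss_small ?mulr0 ?addr0 //; lia.
have [m ->] : exists m, N = (m + n.+1)%N by exists (N - n.+1)%N; lia.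
rewrite !gaussE /qbinom; try lia.
have -> : ((m + n.+1).+1 - n.+1 = m.+1)%N by lia.
have -> : (m + n.+1 - n.+1 = m)%N by lia.
have -> : (m + n.+1 - n = m.+1)%N by lia.
rewrite !qpochS -addSn exprD; field.
by rewrite !qpoch_neq0 !q_nonres.
Qed.

(** * The alternating sum *)

Definition altgauss N n : F := (-1) ^+ n * q ^+ 'C(n, 2) * gauss N n.

Lemma altgaussn0 N : altgauss N 0 = 1.
Proof. by rewrite /altgauss gaussn0 !mulr1. Qed.

Lemma altgauss_small N n : (N < n)%N -> altgauss N n = 0.
Proof. by move=> ?; rewrite /altgauss gauss_small ?mulr0. Qed.

(** By the q-binomial theorem, [altgauss N n] is the coefficient of z^n in (z;q)_N; this is
    multiplication by 1 - z q^N. *)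
Lemma altgauss_rec N n :
  altgauss N.+1 n.+1 = altgauss N n.+1 - q ^+ N * altgauss N n.
Proof.
have [le_nN|lt_Nn] := leqP n N; last first.
  by rewrite !altgauss_small ?mulr0 ?subr0 //; lia.
rewrite /altgauss gauss_pascal binS bin1 -[in q ^+ N](subnK le_nN) !exprD exprS.
ring.
Qed.

Lemma altgauss_sum_rec (f : nat -> F) N :
  \sum_(0 <= n < N.+2) f n * altgauss N.+1 n =
  \sum_(0 <= n < N.+1) (f n - q ^+ N * f n.+1) * altgauss N n.
Proof.
rewrite big_nat_recl // altgaussn0 -(altgaussn0 N).
under eq_bigr do rewrite altgauss_rec mulrBr.
rewrite sumrB big_nat_recr //= (altgauss_small _ _ (ltnSn _)) mulr0 addr0 addrA.
rewrite -(big_nat_recl _ _ (fun i => f i * altgauss N i)) // -sumrB.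
by apply: eq_bigr => i _; ring.
Qed.

Lemma altgauss_sum0 N : \sum_(0 <= n < N.+2) altgauss N.+1 n = 0.
Proof.
have rec M : \sum_(0 <= n < M.+2) altgauss M.+1 n =
             (1 - q ^+ M) * \sum_(0 <= n < M.+1) altgauss M n.
  have := altgauss_sum_rec (fun=> 1) M.
  by under eq_bigr do rewrite mul1r; rewrite mulr1 -big_distrr.
by elim: N => [|N IHN]; rewrite rec ?IHN ?mulr0 // expr0 subrr mul0r.
Qed.

(** Derivative at z = 1 of (z;q)_(N+1) = (1 - z) (zq;q)_N. *)
Lemma altgauss_sum_nat N :
  \sum_(0 <= n < N.+2) n%:R * altgauss N.+1 n = - poch N.
Proof.
elim: N => [|N IHN].
  rewrite altgauss_sum_rec big_nat1 altgaussn0 qpoch0; ring.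
rewrite altgauss_sum_rec qpochS -mulNr -IHN.
transitivity (\sum_(0 <= i < N.+2) (1 - q ^+ N.+1) * (i%:R * altgauss N.+1 i)
              - q ^+ N.+1 * \sum_(0 <= i < N.+2) altgauss N.+1 i).
  rewrite big_distrr -sumrB; apply: eq_bigr => i _ /=; ring.
by rewrite altgauss_sum0 mulr0 subr0 -big_distrr mulrC.
Qed.

(** The second term of Pascal's rule, after [gauss_absorb], carries q^(C(n+2,2) + N - n) = q^(N+1)
    q^C(n+1,2), so these terms add up to a multiple of the sum in [altgauss_sum_nat]. *)
Lemma van_hamme_rec N :
  \sum_(0 <= n < N.+1) (-1) ^+ n * n.+1%:R * q ^+ 'C(n.+2, 2)
      * (gauss N.+1 n.+1 / (1 - q ^+ n.+1)) =
  \sum_(0 <= n < N) (-1) ^+ n * n.+1%:R * q ^+ 'C(n.+2, 2)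
      * (gauss N n.+1 / (1 - q ^+ n.+1))
  + q ^+ N.+1 * poch N / (1 - q ^+ N.+1).
Proof.
have := altgauss_sum_nat N; rewrite big_nat_recl // mulr0n mul0r add0r.
move=> /(canLR (@opprK F)) <-.
rewrite -sumrN mulrAC big_distrr /=.
set b := fun n => (-1) ^+ n * n.+1%:R * q ^+ 'C(n.+2, 2)
      * (gauss N n.+1 / (1 - q ^+ n.+1)).
(* The added term vanishes: [N n+1] = 0 at n = N. *)
have -> : \sum_(0 <= n < N) b n = \sum_(0 <= n < N.+1) b n.
  by rewrite big_nat_recr //= [b N]/b gauss_small // mul0r mulr0 addr0.
rewrite -big_split /= !big_nat; apply: eq_bigr => n /andP[_ le_nN].
rewrite [in LHS]gauss_pascal mulrDl -[X in _ + X]mulrA gauss_absorb mulrDr.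
congr (_ + _); rewrite /altgauss -[in q ^+ N.+1](subnK le_nN) subSS.
have -> : ('C(n.+2, 2) = 'C(n.+1, 2) + n.+1)%N by rewrite binS bin1.
rewrite !exprD (exprS (-1)).
ring.
Qed.

(** * The Durfee-square weights T_(N,n) *)

Definition durfee N n : F :=
  gauss N n * q ^+ (n ^ 2) * (poch N / poch n).

Lemma durfee_n0 N : durfee N 0 = poch N.
Proof. by rewrite /durfee gaussn0 qpoch0 divr1 !mul1r. Qed.

Lemma durfee_small N n : (N < n)%N -> durfee N n = 0.
Proof. by move=> ?; rewrite /durfee gauss_small ?mul0r. Qed.

Lemma durfee_absorb N n :
  q ^+ (2 * n).+1 * durfee N n / (1 - q ^+ n.+1) ^+ 2
  = durfee N.+1 n.+1 / (1 - q ^+ N.+1) ^+ 2.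
Proof.
rewrite /durfee /gauss ltnS; case: leqP => _; last by rewrite !(mul0r, mulr0).
rewrite /qbinom subSS !qpochS.
have -> : (n.+1 ^ 2 = n ^ 2 + (2 * n).+1)%N by lia.
rewrite exprD; field.
by rewrite !qpoch_neq0 !q_nonres.
Qed.

(** From N to N+1, the weight at i keeps the fraction 1 - q^(N+i+1) and passes the rest to i+1, so
    total mass is conserved. *)
Lemma durfee_recS N n :
  durfee N.+1 n.+1 = (1 - q ^+ (N + n).+2) * durfee N n.+1
                     + q ^+ (N + n).+1 * durfee N n.
Proof.
have [lt_nN|] := ltnP n N; last first.
  rewrite leq_eqVlt => /predU1P[<-|lt_Nn]; last by rewrite !durfee_small ?mulr0 ?addr0 //; lia.
  rewrite (durfee_small _ _ (ltnSn _)) /durfee !gaussnn !divff ?qpoch_neq0 //.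
  rewrite mulr0 add0r !mulr1 !mul1r -exprD; congr (_ ^+ _); lia.
have [m ->] : exists m, N = (m + n.+1)%N by exists (N - n.+1)%N; lia.
rewrite /durfee !gaussE /qbinom; try lia.
have -> : ((m + n.+1).+1 - n.+1 = m.+1)%N by lia.
have -> : (m + n.+1 - n.+1 = m)%N by lia.
have -> : (m + n.+1 - n = m.+1)%N by lia.
have -> : (n.+1 ^ 2 = n ^ 2 + n + n.+1)%N by lia.
have -> : ((m + n.+1 + n).+2 = m.+1 + n.+1 + n.+1)%N by lia.
have -> : ((m + n.+1 + n).+1 = m.+1 + n.+1 + n)%N by lia.
rewrite !qpochS -addSn !exprD.
field.
by rewrite !qpoch_neq0 !q_nonres.
Qed.

Lemma durfee_rec0 N : durfee N.+1 0 = (1 - q ^+ N.+1) * durfee N 0.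
Proof. by rewrite !durfee_n0 qpochS mulrC. Qed.

Lemma durfee_sum_rec (f : nat -> F) N :
  \sum_(0 <= n < N.+2) durfee N.+1 n * f n =
  \sum_(0 <= n < N.+1) durfee N n * f n
  + \sum_(0 <= n < N.+1) q ^+ (N + n).+1 * durfee N n * (f n.+1 - f n).
Proof.
rewrite big_nat_recl // durfee_rec0.
under eq_bigr do rewrite durfee_recS mulrDl.
rewrite big_split /= addrA.
(* The kept fractions, reindexed from 0; the top term is zero. *)
have -> : (1 - q ^+ N.+1) * durfee N 0 * f 0%N +
   \sum_(0 <= i < N.+1) (1 - q ^+ (N + i).+2) * durfee N i.+1 * f i.+1 =
   \sum_(0 <= i < N.+1) (1 - q ^+ (N + i).+1) * durfee N i * f i.
  rewrite big_nat_recr //= (durfee_small N N.+1) // mulr0 mul0r addr0.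
  rewrite [RHS]big_nat_recl // addn0; congr (_ + _).
  by apply: eq_bigr => i _; rewrite addnS.
rewrite -!big_split /=; apply: eq_bigr => i _; ring.
Qed.

(** Combinatorially, [durfee N n / poch N] generates the partitions with at most N parts and Durfee
    square of side n. *)
Lemma durfee_sum1 N : \sum_(0 <= n < N.+1) durfee N n = 1.
Proof.
elim: N => [|N IHN]; first by rewrite big_nat1 durfee_n0 qpoch0.
have := durfee_sum_rec (fun=> 1) N.
under eq_bigr do rewrite mulr1.
under [X in _ = X + _]eq_bigr do rewrite mulr1.
by under [X in _ = _ + X]eq_bigr do rewrite subrr mulr0; rewrite IHN big1_eq addr0.
Qed.

Lemma durfee_lambert_rec N :
  \sum_(0 <= n < N.+2) durfee N.+1 n * lambert2 n =
  \sum_(0 <= n < N.+1) durfee N n * lambert2 n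
  + q ^+ N.+1 / (1 - q ^+ N.+1) ^+ 2 - q ^+ N.+1 * poch N / (1 - q ^+ N.+1).
Proof.
rewrite durfee_sum_rec -addrA; congr (_ + _).
(* The increment of [lambert2] brings q^(n+1), and q^(N+n+1) q^(n+1) = q^(N+1) q^(2n+1), as
   [durfee_absorb] requires. *)
transitivity (q ^+ N.+1 / (1 - q ^+ N.+1) ^+ 2
              * \sum_(0 <= n < N.+1) durfee N.+1 n.+1).
  rewrite big_distrr /=; apply: eq_bigr => n _.
  rewrite [RHS]mulrAC -[RHS]mulrA -durfee_absorb /lambert2 [in LHS]big_nat_recr //=.
  have -> : ((N + n).+1 = N.+1 + n)%N by [].
  have -> : ((2 * n).+1 = n + n.+1)%N by lia.
  rewrite !exprD.
  have := q_nonres n; set x := 1 - _ => x0.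
  by field.
(* The sum lacks only the weight at 0, so it equals 1 - (q)_(N+1). *)
have := durfee_sum1 N.+1; rewrite big_nat_recl // durfee_n0.
move=> /(canRL (addKr _)) ->.
by rewrite qpochS; field; rewrite q_nonres.
Qed.

Lemma finite_identity N :
  \sum_(0 <= n < N) (-1) ^+ n * n.+1%:R * q ^+ 'C(n.+2, 2)
      * (gauss N n.+1 / (1 - q ^+ n.+1))
  + \sum_(0 <= n < N.+1) durfee N n * lambert2 n = lambert2 N.
Proof.
elim: N => [|N IHN].
  by rewrite big_nil big_nat1 lambert2_0 mulr0 add0r.
rewrite van_hamme_rec durfee_lambert_rec [RHS]/lambert2 [in RHS]big_nat_recr //=.
rewrite -/(lambert2 N) -IHN; ring.
Qed.

End FiniteIdentity.

(** * Convergence of the series *)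

(* With [s = sqrt r], the sequence [n s^n] is bounded by [1 / (1 - s)]. *)
Lemma cvg_natmul_expr (R : realType) (r : R) : 0 <= r < 1 ->
  n%:R * r ^+ n @[n --> \oo] --> (0 : R).
Proof.
move=> /andP[r0 r1]; set s := Num.sqrt r.
have s0 : 0 <= s by exact: sqrtr_ge0.
have s1 : s < 1 by rewrite -sqrtr1 ltr_sqrt.
have bnd n : n%:R * s ^+ n <= (1 - s)^-1.
  rewrite -div1r ler_pdivlMr ?subr_gt0 //.
  have -> : n%:R * s ^+ n * (1 - s) = (1 - s) * \sum_(i < n) s ^+ n.
    by rewrite sumr_const card_ord -mulr_natl; ring.
  apply: (@le_trans _ _ ((1 - s) * \sum_(i < n) s ^+ i)).
    rewrite ler_pM2l ?subr_gt0 //; apply: ler_sum => i _.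
    by rewrite ler_wiXn2l ?(ltW s1) // ltnW.
  by rewrite -opprB mulNr -subrX1 opprB lerBlDr lerDl exprn_ge0.
apply: (@squeeze_cvgr _ _ _ _ (fun=> 0) (fun n => (1 - s)^-1 * s ^+ n)).
- near=> n; apply/andP; split; first by rewrite mulr_ge0 ?exprn_ge0.
  by rewrite -(sqr_sqrtr r0) -exprM mul2n -addnn exprD mulrA ler_wpM2r ?exprn_ge0.
- exact: cvg_cst.
- rewrite -[X in _ --> X](mulr0 (1 - s)^-1); apply: cvgMl_tmp.
  by apply: cvg_expr; rewrite ger0_norm.
Unshelve. all: by end_near. Qed.

Lemma cvg_natmul_exprC (R : realType) (x : R[i]) : `|x| < 1 ->
  (n%:R * x ^+ n : R[i]^o) @[n --> \oo] --> (0 : R[i]^o).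
Proof.
move=> x1; set r := complex.Re `|x|.
have nx : `|x| = r%:C%C by rewrite /r normc_def.
have r01 : 0 <= r < 1 by rewrite -!ler0c -ltcR -nx x1 normr_ge0.
apply/cvgr0Pnorm_lt => e e0.
(* A positive element of [R[i]] is real, so the estimate reduces to the real case. *)
have ee : e = (complex.Re e)%:C%C by move: e0; case: (e) => a b; rewrite ltcE /= => /andP[/eqP -> _].
have e0' : 0 < complex.Re e by rewrite -ltcR -ee.
have /cvgr0Pnorm_lt/(_ _ e0') := cvg_natmul_expr _ _ r01.
apply: filterS => n.
rewrite ger0_norm ?mulr_ge0 ?exprn_ge0 ?(andP r01).1 // => h.
rewrite normrM normrX nx normr_nat ee -(rmorph_nat (@real_complex R)) -rmorphXn -rmorphM ltcR.
exact: h.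
Qed.

(** The numerator depends on [m] only through terms k x^k, with k = m+1 and k = m, which tend to 0
    when |x| < 1. *)
Lemma sum_natmul_expr (F : fieldType) (x : F) m : 1 - x != 0 ->
  \sum_(1 <= n < m.+1) n%:R * x ^+ n =
  (x - m.+1%:R * x ^+ m.+1 + m%:R * x ^+ m * x ^+ 2) / (1 - x) ^+ 2.
Proof.
move=> x1; elim: m => [|m IHm]; first by rewrite big_nil; field.
by rewrite big_nat_recr //= IHm !exprS; field.
Qed.

Lemma one_sub_expr_neq0 (R : numDomainType) (x : R) k :
  `|x| < 1 -> 1 - x ^+ k.+1 != 0.
Proof.
move=> x1; rewrite subr_eq0; apply/eqP => xk.
have : `|x ^+ k.+1| < 1 by rewrite normrX exprn_ilt1.
by rewrite -xk normr1 ltxx.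
Qed.

Lemma cvg_sum_natmul_expr (R : realType) (x : R[i]) : `|x| < 1 ->
  (\sum_(1 <= n < m) n%:R * x ^+ n : R[i]^o) @[m --> \oo]
    --> (x / (1 - x) ^+ 2 : R[i]^o).
Proof.
move=> x1.
have x1' : 1 - x != 0 by exact: (one_sub_expr_neq0 _ _ 0).
rewrite -cvg_shiftS /=.
under eq_cvg do rewrite sum_natmul_expr //.
have cx := cvg_natmul_exprC _ _ x1.
have -> : x / (1 - x) ^+ 2 = (x - 0 + 0 * x ^+ 2) / (1 - x) ^+ 2.
  by rewrite subr0 mul0r addr0.
apply: (@cvgMr_tmp R[i]); apply: (@cvgD R[i] R[i]^o).
  apply: (@cvgB R[i] R[i]^o); first exact: cvg_cst.
  by rewrite (cvg_shiftS (fun n => n%:R * x ^+ n : R[i]^o)).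
exact: (@cvgMr_tmp R[i]).
Qed.

Lemma cvg_lambert (R : realType) (N : nat) (q : R[i]) : `|q| < 1 ->
  (\sum_(1 <= n < m) (n%:R * q ^+ n * (1 - q ^+ (N * n)) / (1 - q ^+ n)) : R[i]^o)
    @[m --> \oo] --> (\sum_(1 <= k < N.+1) q ^+ k / (1 - q ^+ k) ^+ 2 : R[i]^o).
Proof.
move=> q1.
have qk1 k : `|q ^+ k.+1| < 1 by rewrite normrX exprn_ilt1.
have nz k : 1 - q ^+ k.+1 != 0 by exact: one_sub_expr_neq0.
(* Each partial sum is a finite double sum; after the exchange only N series, one per x = q^k, need
   a limit. *)
rewrite (_ : (fun _ => _) = (fun m => \sum_(1 <= k < N.+1) \sum_(1 <= n < m) n%:R * (q ^+ k) ^+ n)).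
  rewrite big_add1 /=; apply: (@cvg_trans _ ((fun m => \sum_(0 <= k < N) \sum_(1 <= n < m) n%:R * (q ^+ k.+1) ^+ n : R[i]^o) @ \oo)).
    by under eq_cvg do rewrite big_add1.
  apply: cvg_big => [|k _]; first exact: add_continuous.
  exact: cvg_sum_natmul_expr.
apply/funext => m; rewrite exchange_big !big_nat /=; apply: eq_bigr => -[//|n] _.
rewrite big_add1 /= -big_distrr.
under eq_bigr do rewrite -exprM mulnC exprM exprS.
rewrite -big_distrr big_mkord /= mulnC exprM -!mulrA; congr (_ * (_ * _)).
rewrite -opprB subrX1 -mulNr opprB mulrAC divff ?mul1r //.
Qed.

(* R[i] is the field of complex numbers over R; the alias R[i]^o is the same
   type equipped with its normed topology, in which the series is summed. *)
Theorem theorem2p1 (R : realType) (N : nat) (q : R[i]) (hq : `|q| < 1) :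
  let S : nat -> R[i]^o := fun m =>
    \sum_(1 <= n < m) (n%:R * q ^+ n * (1 - q ^+ (N * n)) / (1 - q ^+ n)) in
  cvgn S /\
  (qpoch q q N)^-1 *
    (\sum_(1 <= n < N.+1)
       qbinom q N n *
       ((-1) ^+ (n - 1) * n%:R * q ^+ ((n * (n + 1)) %/ 2) / (1 - q ^+ n)))
  + \sum_(1 <= n < N.+1)
      qbinom q N n * (q ^+ (n ^ 2) / qpoch q q n) *
      (\sum_(1 <= k < n.+1) q ^+ k / (1 - q ^+ k) ^+ 2)
  = (qpoch q q N)^-1 * limn S.
Proof.
move=> S.
have nz k : 1 - q ^+ k.+1 != 0 by exact: one_sub_expr_neq0.
have cS := cvg_lambert R N q hq.
split; first by apply/cvg_ex; exists (lambert2 _ q N).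
have -> : limn S = lambert2 _ q N by exact: (cvg_lim (@norm_hausdorff _ _) cS).
rewrite -(finite_identity _ _ nz N) mulrDr; congr (_ + _).
  rewrite big_add1 /=; congr (_ * _); rewrite !big_nat.
  apply: eq_bigr => n /andP[_ lt_nN].
  have -> : ((n.+1 * (n.+1 + 1)) %/ 2 = 'C(n.+2, 2))%N by rewrite bin2 /=; lia.
  rewrite gaussE // subn1 /= [LHS]mulrC -[LHS]mulrA; congr (_ * _).
  exact: mulrC.
rewrite [in RHS]big_nat_recl // lambert2_0 mulr0 add0r.
rewrite big_distrr big_add1 !big_nat /=; apply: eq_bigr => n lt_nN.
rewrite /durfee gaussE // -/(lambert2 _ q n.+1); field.
by rewrite !qpoch_neq0.
Qed.
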